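(* Let $J\subset\mathbb R$ be an interval, let $A$ be a continuous real $n\times n$ matrix function on $J$, and let $G$ be a multiplicative group of real continuously differentiable on $J$ nonsingular matrices of order $n$. Suppose the system $\dfrac{dx}{dt}=A(t)x$ is reducible to the system with constant coefficients $\dfrac{dy}{dt}=By$ by a transformation matrix $\mathrm g\in G$, and let $C=B^{T}$. Let $\nu=\overset{*}{\nu}+\widetilde\nu\, i$ ($\overset{*}{\nu}=\mathrm{Re}\,\nu$, $\widetilde\nu=\mathrm{Im}\,\nu$) be a complex eigenvector of $C$ corresponding to the eigenvalue $\lambda=\overset{*}{\lambda}+\widetilde\lambda\, i$ ($\overset{*}{\lambda}=\mathrm{Re}\,\lambda$, $\widetilde\lambda=\mathrm{Im}\,\lambda$). Then the system $\dfrac{dx}{dt}=A(t)x$ has the first integrals $$F_1\colon(t,x)\mapsto\bigl((\overset{*}{\nu}\,\mathrm g(t)x)^2+(\widetilde\nu\,\mathrm g(t)x)^2\bigr)\exp(-2\overset{*}{\lambda}\,t)\quad\text{for all }(t,x)\in J\times\mathbb R^n$$ and $$F_2\colon(t,x)\mapsto\arctan\frac{\widetilde\nu\,\mathrm g(t)x}{\overset{*}{\nu}\,\mathrm g(t)x}-\widetilde\lambda\,t\quad\text{for all }(t,x)\in\Lambda,$$ where $\Lambda$ is any domain contained in $\{(t,x)\colon t\in J,\ \overset{*}{\nu}\,\mathrm g(t)x\neq0\}$.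
   Context: A domain is an open arcwise connected set. Vectors $\nu$ act as rows in $\nu\,\mathrm g(t)x$ (i.e. $\nu y=\sum_\xi\nu_\xi y_\xi$ with $y=\mathrm g(t)x$) and as columns in $C\nu=\lambda\nu$; eigenvectors are non-zero. The system $dx/dt=A(t)x$ is reducible to $dy/dt=By$ ($B$ a real constant $n\times n$ matrix) by $\mathrm g\in G$ if the substitution $y=\mathrm g(t)x$ transforms the first system into the second; in particular $\dfrac{d\,\mathrm g(t)}{dt}=B\,\mathrm g(t)-\mathrm g(t)A(t)$ for all $t\in J$. A first integral of $dx/dt=X(t,x)$ on a domain $G'$ is a continuously differentiable function $F\colon G'\to\mathbb R$ with $\partial_tF(t,x)+\sum_{\xi=1}^nX_\xi(t,x)\,\partial_{x_\xi}F(t,x)=0$ for all $(t,x)\in G'$. *)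

(* Defs.v *)
From HB Require Import structures.
From mathcomp Require Import all_boot all_order all_algebra.
From mathcomp Require Import all_classical all_reals all_analysis.
From mathcomp Require Import complex.

Set Implicit Arguments.
Unset Strict Implicit.
Unset Printing Implicit Defensive.

Import Order.TTheory GRing.Theory Num.Theory.
Import numFieldNormedType.Exports.

Local Open Scope ring_scope.
Local Open Scope classical_set_scope.

Section Definitions.
Context {R : realType} {n : nat}.

Definition arcwise_connected (D : set (R * 'cV[R]_n)) : Prop :=
  forall p q, D p -> D q ->
    exists gamma : R -> R * 'cV[R]_n,
      [/\ {within `[0, 1], continuous gamma}, gamma 0 = p, gamma 1 = q &
          forall s : R, 0 <= s <= 1 -> D (gamma s)].

Definition domain (D : set (R * 'cV[R]_n)) : Prop :=
  open D /\ arcwise_connected D.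

(* [J] is meant to be open, so that two-sided derivatives at points of [J]
   do not depend on the values taken outside [J]. *)
Definition C1_on {V : normedModType R} (J : set R) (f : R -> V) : Prop :=
  (forall t, J t -> derivable f t 1) /\ {within J, continuous f^`()}.

(* Matrix functions are total on [R] but only matter on [J]; hence closure under
   the group operations is required up to equality on [J]. *)
Definition C1_matrix_group (J : set R) (G : set (R -> 'M[R]_n)) : Prop :=
  [/\ forall g, G g -> C1_on J g /\ (forall t, J t -> g t \in unitmx),
      exists2 e, G e & forall t, J t -> e t = 1%:M,
      forall g h, G g -> G h ->
        exists2 k, G k & forall t, J t -> k t = g t *m h t &
      forall g, G g -> exists2 k, G k & forall t, J t -> k t = invmx (g t)].

(* The right-hand side of a system dx/dt = X(t, x). *)
Definition system := R -> 'cV[R]_n -> 'cV[R]_n.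

Definition linear_system (A : R -> 'M[R]_n) : system := fun t x => A t *m x.

(* The substitution y = g(t) x of the unknown function turns the equation
   dx/dt = X(t, x) into the equation dy/dt = Y(t, y) at every time of [J]. *)
Definition transforms_by (J : set R) (g : R -> 'M[R]_n) (X Y : system) : Prop :=
  forall x : R -> 'cV[R]_n, (forall t, J t -> derivable x t 1) ->
  forall t, J t ->
    let y := fun s => g s *m x s in
    x^`() t = X t (x t) <-> y^`() t = Y t (y t).

Definition partial_t (F : R * 'cV[R]_n -> R) (p : R * 'cV[R]_n) : R :=
  'D_((1, 0) : R * 'cV[R]_n) F p.

Definition partial_x (i : 'I_n) (F : R * 'cV[R]_n -> R) (p : R * 'cV[R]_n) : R :=
  'D_((0, delta_mx i 0) : R * 'cV[R]_n) F p.

Definition continuously_differentiable (D : set (R * 'cV[R]_n))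
    (F : R * 'cV[R]_n -> R) : Prop :=
  [/\ forall p, D p -> derivable F p ((1, 0) : R * 'cV[R]_n),
      {within D, continuous (partial_t F)},
      forall i p, D p -> derivable F p ((0, delta_mx i 0) : R * 'cV[R]_n) &
      forall i, {within D, continuous (partial_x i F)}].

Definition first_integral (X : system) (D : set (R * 'cV[R]_n))
    (F : R * 'cV[R]_n -> R) : Prop :=
  [/\ domain D, continuously_differentiable D F &
      forall p, D p ->
        partial_t F p + \sum_(i < n) X p.1 p.2 i 0 * partial_x i F p = 0].

(* A vector acting as a row. *)
Definition row_action (nu y : 'cV[R]_n) : R := \sum_(i < n) nu i 0 * y i 0.

Definition Re_vec (nu : 'cV[R[i]]_n) : 'cV[R]_n := map_mx (@complex.Re R) nu.

Definition Im_vec (nu : 'cV[R[i]]_n) : 'cV[R]_n := map_mx (@complex.Im R) nu.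

(* [nu] is a complex eigenvector of the real matrix [C], acting on columns. *)
Definition eigenvector (C : 'M[R]_n) (lambda : R[i]) (nu : 'cV[R[i]]_n) : Prop :=
  nu != 0 /\ map_mx (real_complex R) C *m nu = lambda *: nu.

End Definitions.

Arguments system : clear implicits.

(* Main.v *)
(* Writing a and b for the real and imaginary parts of nu . y with y = g(t) x,
   the eigenvector equation says that a' = lr a - li b and b' = li a + lr b along
   the flow, because g' = B g - g A on J.  Hence a^2 + b^2 is multiplied by
   exp(2 lr t), and the angle atan(b / a) grows at the constant speed li.  Both
   integrals are functions of a, b and t, so the chain rule reduces everything
   to the gradients of a and b. *)

Require Import Defs.
From HB Require Import structures.
From mathcomp Require Import all_boot all_order all_algebra.
From mathcomp Require Import all_classical all_reals all_analysis.
From mathcomp Require Import complex ring lra.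

Set Implicit Arguments.
Unset Strict Implicit.
Unset Printing Implicit Defensive.

Import Order.TTheory GRing.Theory Num.Theory.
Import numFieldNormedType.Exports.

Local Open Scope ring_scope.
Local Open Scope classical_set_scope.

(** * Derivatives along a vector in a normed space *)

Section DirectionalDerivatives.
Context {R : realType} {V : normedModType R}.

(** Both sides are limits of the same difference quotients. This carries rules for one real variable
    over to directional derivatives. *)
Lemma is_derive_line {W : normedModType R} (f : V -> W) p v d :
  is_derive p v f d <-> is_derive (0 : R) (1 : R) (fun h : R => f (h *: v + p)) d.
Proof.
have e : 'D_v f p = 'D_1 (fun h : R => f (h *: v + p)) 0.
  rewrite /derive; set g1 := fun h => h^-1 *: _; set g2 := fun h => h^-1 *: _.
  suff -> : g1 = g2 by [].
  by apply/funext => h; rewrite /g1 /g2 /= addr0 scale0r add0r [_%:A]mulr1.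
split=> -[df <-]; split=> //; first exact: (derivable1P _ _ _).1.
exact: (derivable1P _ _ _).2.
Qed.

(** Restricted to the line through [p] along [v], this is the one-variable chain rule;
    differentiability of [f] along [v] alone suffices. *)
Lemma is_derive_comp_real (phi : R -> R) (f : V -> R) p v dphi df :
  is_derive (f p) 1 phi dphi -> is_derive p v f df ->
  is_derive p v (phi \o f) (dphi * df).
Proof.
move=> hphi /is_derive_line hf; apply/is_derive_line.
by apply: is_derive1_comp; rewrite scale0r add0r.
Qed.

Lemma is_derive_linear {W : normedModType R} (f : {linear V -> W}) p v :
  continuous f -> is_derive p v f (f v).
Proof.
move=> cf; apply: DeriveDef.
  by apply/diff_derivable/linear_differentiable.
by rewrite deriveE ?diff_lin//; apply/linear_differentiable.
Qed.

Lemma is_derive_mxP m n (M : V -> 'M[R]_(m, n)) M' p v :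
  is_derive p v M M' <-> forall i j, is_derive p v (fun q => M q i j) (M' i j).
Proof.
split=> [[dM <-] i j|dM].
  by rewrite derive_mx// mxE; apply/derivableP; move/derivable_mxP: dM.
have dM' : derivable M p v by apply/derivable_mxP => i j; have [] := dM i j.
apply: DeriveDef => //; rewrite derive_mx//; apply/matrixP => i j.
by rewrite mxE; have [] := dM i j.
Qed.

Lemma is_derive_mulmx m n k (M : V -> 'M[R]_(m, n)) (N : V -> 'M[R]_(n, k))
    M' N' p v :
  is_derive p v M M' -> is_derive p v N N' ->
  is_derive p v (fun q => M q *m N q) (M' *m N p + M p *m N').
Proof.
move=> /is_derive_mxP dM /is_derive_mxP dN; apply/is_derive_mxP => i j.
have -> : (fun q => (M q *m N q) i j) =
    \sum_(l < n) ((fun q => M q i l) * (fun q => N q l j)).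
  by apply/funext => q; rewrite mxE fct_sumE.
rewrite !mxE -big_split /=; apply: is_derive_eq; apply: eq_bigr => l _.
by rewrite addrC [_ *: M' _ _]mulrC.
Qed.

End DirectionalDerivatives.

Lemma is_derive_affine {R : realType} {V : normedModType R} (u w : V) (t s : R) :
  is_derive s (1 : R) (fun s => (s - t) *: w + u) w.
Proof.
apply/is_derive_line.
have -> : (fun h : R => (h *: (1 : R) + s - t) *: w + u) =
    (fun h : R => id (h *: w + ((s - t) *: w + u))).
  by apply/funext => h /=; rewrite [_%:A]mulr1 -addrA scalerDl -addrA.
by apply/(is_derive_line id).
Qed.

(** Serves for partial derivatives, whose closed form [h] is known on [D] only: on an open set,
    continuity within the set is continuity at each of its points. *)
Lemma within_continuous_eq {T U : topologicalType} (D : set T) (f h : T -> U) :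
  open D -> (forall q, D q -> h q = f q) ->
  (forall q, D q -> {for q, continuous h}) -> {within D, continuous f}.
Proof.
move=> oD hf ch; apply: (@subspace_eq_continuous _ _ _ h).
  by move=> q; rewrite inE => /hf.
by rewrite continuous_open_subspace// => q; rewrite inE => /ch.
Qed.

Lemma continuous_mulmx_entry {R : realType} {T : topologicalType} m n k
    (M : T -> 'M[R]_(m, n)) (N : T -> 'M[R]_(n, k)) p :
  (forall i j, {for p, continuous (fun q => M q i j)}) ->
  (forall i j, {for p, continuous (fun q => N q i j)}) ->
  forall i j, {for p, continuous (fun q => (M q *m N q) i j)}.
Proof.
move=> cM cN i j.
have -> : (fun q => (M q *m N q) i j) = (fun q => \sum_l M q i l * N q l j).
  by apply/funext => q; rewrite mxE.
apply: cvg_big => [|l _]; first exact: add_continuous.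
exact: cvgM (cM i l) (cN l j).
Qed.

(** * The phase space, row actions and the real form of the eigenvector equation *)

Section PhaseSpace.
Context {R : realType} {n : nat}.
Implicit Types p v : R * 'cV[R]_n.

Lemma is_derive_fst p v : is_derive p v fst v.1.
Proof. by apply: is_derive_linear => q; exact: cvg_fst. Qed.

Lemma is_derive_snd p v : is_derive p v snd v.2.
Proof. by apply: is_derive_linear => q; exact: cvg_snd. Qed.

Lemma domain_cylinder (J : set R) :
  is_interval J -> open J -> domain (J `*` [set: 'cV[R]_n]).
Proof.
move=> iJ oJ; split.
  have -> : J `*` setT = (@fst R 'cV[R]_n) @^-1` J.
    by apply/seteqP; split=> -[t x] //= [].
  by apply: open_comp => // q _; exact: cvg_fst.
move=> p q [/= Jp _] [/= Jq _]; exists (fun s => s *: (q - p) + p); split.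
- apply: continuous_subspaceT => s.
  by apply: cvgD; [exact: scalel_continuous|exact: cvg_cst].
- by rewrite scale0r add0r.
- by rewrite scale1r subrK.
- move=> s /andP[s0 s1]; split=> //=.
  (* The arc is a straight segment. Its time component lies between the two end times, and the
     interval property wants these in increasing order. *)
  have [pq|/ltW qp] := leP p.1 q.1.
  + apply: (iJ _ _ Jp Jq); rewrite /GRing.scale /=; apply/andP; split; nra.
  + apply: (iJ _ _ Jq Jp); rewrite /GRing.scale /=; apply/andP; split; nra.
Qed.

Lemma row_actionE (w y : 'cV[R]_n) : row_action w y = (w^T *m y) 0 0.
Proof. by rewrite mxE; apply: eq_bigr => i _; rewrite mxE. Qed.

Lemma row_action_mulmx (w y : 'cV[R]_n) (M : 'M[R]_n) :
  row_action w (M *m y) = row_action (M^T *m w) y.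
Proof. by rewrite !row_actionE trmx_mul trmxK mulmxA. Qed.

(** With [M] the value of [g] and [y] the velocity [A(t) x], this sums the spatial terms of the
    derivative along the flow, by linearity in [y]. *)
Lemma row_action_sum_delta (w y : 'cV[R]_n) (M : 'M[R]_n) :
  \sum_i y i 0 * row_action w (M *m delta_mx i 0) = row_action w (M *m y).
Proof.
rewrite row_action_mulmx; apply: eq_bigr => i _.
by rewrite row_action_mulmx mulrC; congr (_ * _); rewrite row_actionE -colE !mxE.
Qed.

Lemma continuous_row_action {T : topologicalType} (w : 'cV[R]_n)
    (y : T -> 'cV[R]_n) (p : T) :
  (forall i j, {for p, continuous (fun q => y q i j)}) ->
  {for p, continuous (fun q => row_action w (y q))}.
Proof.
move=> cy; apply: cvg_big => [|i _]; first exact: add_continuous.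
by apply: cvgM; [exact: cvg_cst|exact: cy].
Qed.

(** As [C] is real, it commutes with taking real and imaginary parts; only the product of [lambda]
    and [nu] mixes them. *)
Lemma eigenvector_Re_Im (C : 'M[R]_n) (lambda : R[i]) (nu : 'cV[R[i]]_n) :
  eigenvector C lambda nu ->
  C *m Re_vec nu =
    complex.Re lambda *: Re_vec nu - complex.Im lambda *: Im_vec nu /\
  C *m Im_vec nu =
    complex.Im lambda *: Re_vec nu + complex.Re lambda *: Im_vec nu.
Proof.
move=> [_ /matrixP h]; split; apply/matrixP => i j.
  have /(congr1 (@complex.Re R)) := h i j; rewrite !mxE raddf_sum /=.
  under eq_bigr => k _ do rewrite mxE; move=> e.
  under eq_bigr => k _ do rewrite mxE.
  transitivity (complex.Re (lambda * nu i j)); last first.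
    by case: lambda {h e} (nu i j) => a b [c d].
  rewrite -e; apply: eq_bigr => k _; case: (nu k j) => c d /=.
  by rewrite mul0r subr0.
have /(congr1 (@complex.Im R)) := h i j; rewrite !mxE raddf_sum /=.
under eq_bigr => k _ do rewrite mxE; move=> e.
under eq_bigr => k _ do rewrite mxE.
transitivity (complex.Im (lambda * nu i j)); last first.
  by case: lambda {h e} (nu i j) => a b [c d] /=; rewrite addrC.
rewrite -e; apply: eq_bigr => k _; case: (nu k j) => c d /=.
by rewrite mul0r addr0.
Qed.

End PhaseSpace.

(* Only the affine curves x(s) = v + (s - t) A(t) v are needed, with v ranging
   over the standard basis. *)
Lemma transforms_by_linear {R : realType} {n : nat} (J : set R)
    (A : R -> 'M[R]_n) (B : 'M[R]_n) (g : R -> 'M[R]_n) t :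
  transforms_by J g (linear_system A) (linear_system (fun _ => B)) ->
  J t -> derivable g t 1 -> is_derive t (1 : R) g (B *m g t - g t *m A t).
Proof.
move=> hred Jt dg; apply: DeriveDef => //; apply/matrixP => i j.
pose v : 'cV[R]_n := delta_mx j 0.
pose x (s : R) := (s - t) *: (A t *m v) + v.
have dx s : is_derive s (1 : R) x (A t *m v) by exact: is_derive_affine.
have xt : x t = v by rewrite /x subrr scale0r add0r.
have dgx := is_derive_mulmx (derivableP dg) (dx t).
have [hx _] := hred x (fun s _ => @ex_derive _ _ _ _ _ _ _ (dx s)) t Jt.
(* The curve [x] satisfies the first system at time [t], so its image satisfies the second one
   there; the left side is the product rule for that image. *)
have : 'D_1 g t *m x t + g t *m (A t *m v) = B *m (g t *m x t).
  rewrite -(@derive_val _ _ _ _ _ _ _ dgx) -derive1E.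
  by apply: hx; rewrite derive1E /linear_system xt; exact: derive_val.
rewrite xt => /(canRL (addrK _)).
(* Applying a matrix to the basis vector [v] extracts its column [j]. *)
rewrite !mulmxA -mulmxBl => /matrixP/(_ i 0).
by rewrite -!colE !mxE.
Qed.

(** * Linear functionals of [g(t) x] and their derivatives along the flow *)

Section LinearSystem.
Context {R : realType} {n : nat} (J : set R) (A : R -> 'M[R]_n).
Context (B : 'M[R]_n) (g : R -> 'M[R]_n).
Hypothesis cA : forall t, J t -> {for t, continuous A}.
Hypothesis dg : forall t, J t -> is_derive t (1 : R) g (B *m g t - g t *m A t).

(** The functional [w] read in the new unknown [y = g(t) x]; the real and imaginary parts of [nu]
    give a and b. *)
Definition dual_coord (w : 'cV[R]_n) (p : R * 'cV[R]_n) : R :=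
  row_action w (g p.1 *m p.2).

Let cst_entry (m k : nat) (M : 'M[R]_(m, k)) (p : R * 'cV[R]_n) i j :
  {for p, continuous (fun _ : R * 'cV[R]_n => M i j)}.
Proof. exact: cvg_cst. Qed.

Let cg (p : R * 'cV[R]_n) : J p.1 ->
  forall i j, {for p, continuous (fun q => g q.1 i j)}.
Proof.
move=> Jp i j.
have /derivable1_diffP/differentiable_continuous cgij :
    derivable (fun s => g s i j) p.1 1.
  by have [/derivable_mxP] := dg Jp.
apply: (@continuous_comp _ _ _ fst (fun s => g s i j)) => //; exact: cvg_fst.
Qed.

Let cA_entry (p : R * 'cV[R]_n) : J p.1 ->
  forall i j, {for p, continuous (fun q => A q.1 i j)}.
Proof.
move=> Jp i j.
apply: (@continuous_comp _ _ _ fst (fun s => A s i j)); first exact: cvg_fst.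
apply: (@continuous_comp _ _ _ A (fun M : 'M[R]_n => M i j)); first exact: cA.
exact: coord_continuous.
Qed.

Let csnd (p : R * 'cV[R]_n) i j :
  {for p, continuous (fun q : R * 'cV[R]_n => q.2 i j)}.
Proof.
apply: (@continuous_comp _ _ _ snd (fun y : 'cV[R]_n => y i j)).
  exact: cvg_snd.
exact: coord_continuous.
Qed.

Lemma continuous_dual_coord w p : J p.1 -> {for p, continuous (dual_coord w)}.
Proof.
move=> Jp; apply: continuous_row_action; apply: continuous_mulmx_entry => //.
exact: cg.
Qed.

Lemma is_derive_dual_coord w p v : J p.1 ->
  is_derive p v (dual_coord w)
    (row_action w (v.1 *: (B *m g p.1 - g p.1 *m A p.1) *m p.2 + g p.1 *m v.2)).
Proof.
move=> Jp.
have dgf : is_derive p v (fun q => g q.1)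
    (v.1 *: (B *m g p.1 - g p.1 *m A p.1)).
  apply/is_derive_mxP => i j; rewrite mxE mulrC.
  apply: (is_derive_comp_real (phi := fun s => g s i j)); last first.
    exact: is_derive_fst.
  by move: i j; apply/is_derive_mxP/dg.
rewrite row_actionE.
have := is_derive_mulmx (is_derive_cst w^T p v)
  (is_derive_mulmx dgf (is_derive_snd p v)).
rewrite mul0mx add0r => /is_derive_mxP/(_ 0 0).
by congr (is_derive _ _ _ _); apply/funext => q; rewrite /dual_coord row_actionE.
Qed.

(* The partial derivatives of [dual_coord w] with respect to t and to x_i. *)
Let ft w p := dual_coord (B^T *m w) p - row_action w (g p.1 *m (A p.1 *m p.2)).

Let fx w i (p : R * 'cV[R]_n) := row_action w (g p.1 *m delta_mx i 0).

Let is_derive_t w p : J p.1 -> is_derive p (1, 0) (dual_coord w) (ft w p).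
Proof.
move=> Jp; apply: is_derive_eq; first exact: is_derive_dual_coord.
rewrite scale1r mulmx0 addr0 mulmxBl /ft /dual_coord -!mulmxA.
by rewrite -row_action_mulmx !row_actionE mulmxBr !mxE.
Qed.

Let is_derive_x w i p : J p.1 ->
  is_derive p (0, delta_mx i 0) (dual_coord w) (fx w i p).
Proof.
move=> Jp; apply: is_derive_eq; first exact: is_derive_dual_coord.
by rewrite scale0r mul0mx add0r.
Qed.

Let continuous_ft w p : J p.1 -> {for p, continuous (ft w)}.
Proof.
move=> Jp; apply: cvgB; first exact: continuous_dual_coord.
apply: (continuous_row_action (y := fun q => g q.1 *m (A q.1 *m q.2))).
apply: continuous_mulmx_entry; first exact: cg.
by apply: continuous_mulmx_entry => //; exact: cA_entry.
Qed.

Let continuous_fx w i p : J p.1 -> {for p, continuous (fx w i)}.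
Proof.
move=> Jp; apply: continuous_row_action; apply: continuous_mulmx_entry => //.
exact: cg.
Qed.

(** Here [al], [be] and [ga] are the partial derivatives of F in a, b and t. Along the flow the
    functional of [w] has derivative that of [B^T *m w], so the last hypothesis says that F is
    constant along the flow. *)
Lemma first_integral_of_gradient (wa wb : 'cV[R]_n)
    (D : set (R * 'cV[R]_n)) (F al be ga : R * 'cV[R]_n -> R) :
  domain D -> (forall p, D p -> J p.1) ->
  (forall p, D p -> [/\ {for p, continuous al}, {for p, continuous be} &
    {for p, continuous ga}]) ->
  (forall p v da db, D p ->
    is_derive p v (dual_coord wa) da -> is_derive p v (dual_coord wb) db ->
    is_derive p v F (al p * da + be p * db + ga p * v.1)) ->
  (forall p, D p -> al p * dual_coord (B^T *m wa) p
    + be p * dual_coord (B^T *m wb) p + ga p = 0) ->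
  first_integral (linear_system A) D F.
Proof.
move=> domD DJ cF dF F0.
have dFt p : D p ->
    is_derive p (1, 0) F (al p * ft wa p + be p * ft wb p + ga p).
  move=> Dp; have Jp := DJ p Dp.
  by have := dF _ _ _ _ Dp (is_derive_t wa Jp) (is_derive_t wb Jp); rewrite mulr1.
have dFx i p : D p ->
    is_derive p (0, delta_mx i 0) F (al p * fx wa i p + be p * fx wb i p).
  move=> Dp; have Jp := DJ p Dp.
  by have := dF _ _ _ _ Dp (is_derive_x wa i Jp) (is_derive_x wb i Jp);
    rewrite mulr0 addr0.
have oD := domD.1; split=> //; first split.
- by move=> p /dFt[].
- apply: (within_continuous_eq oD
    (h := fun p => al p * ft wa p + be p * ft wb p + ga p)).
    by move=> p /dFt[_ <-].
  move=> p Dp; have [cal cbe cga] := cF p Dp; have Jp := DJ p Dp.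
  apply: cvgD cga; apply: cvgD; [apply: cvgM cal _|apply: cvgM cbe _];
    exact: continuous_ft.
- by move=> i p /(dFx i)[].
- move=> i.
  apply: (within_continuous_eq oD
    (h := fun p => al p * fx wa i p + be p * fx wb i p)).
    by move=> p /(dFx i)[_ <-].
  move=> p Dp; have [cal cbe _] := cF p Dp; have Jp := DJ p Dp.
  apply: cvgD; [apply: cvgM cal _|apply: cvgM cbe _]; exact: continuous_fx.
- move=> p Dp; have [_ Ft] := dFt p Dp; rewrite /partial_t Ft.
  have sumX w : \sum_i (A p.1 *m p.2) i 0 * fx w i p
      = row_action w (g p.1 *m (A p.1 *m p.2)) by exact: row_action_sum_delta.
  have -> : \sum_(i < n) linear_system A p.1 p.2 i 0 * partial_x i F p =
      al p * row_action wa (g p.1 *m (A p.1 *m p.2))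
      + be p * row_action wb (g p.1 *m (A p.1 *m p.2)).
    rewrite -!sumX !mulr_sumr -big_split /=; apply: eq_bigr => i _.
    by have [_ Fx] := dFx i p Dp; rewrite /partial_x Fx /linear_system; ring.
  (* The terms with [A] in the time derivative cancel those of the spatial sum. *)
  rewrite -[RHS](F0 p Dp) /ft; ring.
Qed.

End LinearSystem.

(** * The two integrals attached to a complex eigenvector *)

Lemma dual_coordD {R : realType} {n : nat} (g : R -> 'M[R]_n) (a b : R)
    (u w : 'cV[R]_n) p :
  dual_coord g (a *: u + b *: w) p = a * dual_coord g u p + b * dual_coord g w p.
Proof.
rewrite /dual_coord !row_actionE linearD /= !linearZ /= mulmxDl -!scalemxAl.
by rewrite !mxE.
Qed.

Theorem theorem3p2 (R : realType) (n : nat) (J : set R)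
  (hJ : is_interval J) (hJo : open J)
  (A : R -> 'M[R]_n) (hA : {within J, continuous A})
  (G : set (R -> 'M[R]_n)) (hG : C1_matrix_group J G)
  (B : 'M[R]_n) (g : R -> 'M[R]_n) (hg : G g)
  (hred : transforms_by J g (linear_system A) (linear_system (fun _ => B)))
  (nu : 'cV[R[i]]_n) (lambda : R[i])
  (hnu : eigenvector B^T lambda nu) :
  first_integral (linear_system A) (J `*` setT)
    (fun p => (row_action (Re_vec nu) (g p.1 *m p.2) ^+ 2
               + row_action (Im_vec nu) (g p.1 *m p.2) ^+ 2)
              * expR (- 2 * complex.Re lambda * p.1))
  /\
  (forall Lambda : set (R * 'cV[R]_n),
    domain Lambda ->
    Lambda `<=` [set p | J p.1 /\ row_action (Re_vec nu) (g p.1 *m p.2) != 0] ->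
    first_integral (linear_system A) Lambda
      (fun p => atan (row_action (Im_vec nu) (g p.1 *m p.2)
                      / row_action (Re_vec nu) (g p.1 *m p.2))
                - complex.Im lambda * p.1)).
Proof.
have cA t : J t -> {for t, continuous A}.
  move=> Jt; move: hA; rewrite continuous_open_subspace// => /(_ t).
  by rewrite inE; apply.
have dg t : J t -> is_derive t (1 : R) g (B *m g t - g t *m A t).
  move=> Jt; apply: (transforms_by_linear hred Jt).
  by have [/(_ g hg)[[dgJ _] _] _ _ _] := hG; exact: dgJ.
have [CRe CIm] := eigenvector_Re_Im hnu.
rewrite -scaleNr in CRe.
set lr := complex.Re lambda in CRe CIm *; set li := complex.Im lambda in CRe CIm *.
set wa := Re_vec nu in CRe CIm *; set wb := Im_vec nu in CRe CIm *.
have cw w p : J p.1 -> {for p, continuous (dual_coord g w)}.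
  exact: (continuous_dual_coord dg).
split.
- pose e (p : R * 'cV[R]_n) := expR (- 2 * lr * p.1).
  have de p v : is_derive p v e (e p * (- 2 * lr * v.1)).
    apply: (is_derive_comp_real (f := (- 2 * lr) \*: fst)).
    by apply: is_deriveZ; exact: is_derive_fst.
  have ce p : {for p, continuous e}.
    apply: (@continuous_comp _ _ _ (fun p : R * 'cV[R]_n => - 2 * lr * p.1) expR).
      by apply: cvgM; [exact: cvg_cst|exact: cvg_fst].
    exact: continuous_expR.
  pose a := dual_coord g wa; pose b := dual_coord g wb.
  apply: (first_integral_of_gradient cA dg (wa := wa) (wb := wb)
    (al := fun p => 2 * a p * e p) (be := fun p => 2 * b p * e p)
    (ga := fun p => (a p * a p + b p * b p) * e p * (- 2 * lr))).
  + exact: domain_cylinder.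
  + by move=> p [].
  + move=> p [Jp _]; have ca := cw wa p Jp; have cb := cw wb p Jp.
    split; repeat first [exact: ce | exact: ca | exact: cb | exact: cvg_cst
      | apply: cvgM | apply: cvgD].
  + move=> p v da db Dp ha hb.
    (* As an algebraic expression in functions, F is differentiated by instance inference from [ha],
       [hb] and [de]. *)
    rewrite [X in is_derive _ _ X](_ : _ = (a ^+ 2 + b ^+ 2) * e); last by [].
    apply: is_derive_eq.
    rewrite (_ : (a ^+ 2 + b ^+ 2) p = a p * a p + b p * b p)// !expr1.
    rewrite /GRing.scale /=; ring.
  (* The cross terms in [li] cancel, and the remaining 2 [lr] (a^2 + b^2) is offset by the
     derivative of the exponential. *)
  + move=> p _; rewrite CRe CIm !dual_coordD -/a -/b -/(a p) -/(b p); ring.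
- move=> D domD DJ.
  pose a := dual_coord g wa; pose b := dual_coord g wb.
  have sq0 p : D p -> a p ^+ 2 + b p ^+ 2 != 0.
    move=> /DJ[_ a0]; rewrite lt0r_neq0// ltr_wpDr ?sqr_ge0//.
    by rewrite exprn_even_gt0.
  (* The coefficients are the partial derivatives of the polar angle of (a, b), and of - [li] t. *)
  apply: (first_integral_of_gradient cA dg (wa := wa) (wb := wb)
    (al := fun p => - b p / (a p * a p + b p * b p))
    (be := fun p => a p / (a p * a p + b p * b p))
    (ga := fun p => - li)) => //.
  + by move=> p /DJ[].
  + move=> p Dp; have [Jp _] := DJ p Dp.
    have ca := cw wa p Jp; have cb := cw wb p Jp.
    have cq : {for p, continuous (fun p => (a p * a p + b p * b p)^-1)}.
      apply: cvgV; first exact: sq0.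
      by apply: cvgD; [exact: (cvgM ca ca)|exact: (cvgM cb cb)].
    split; [|exact: cvgM ca cq|exact: cvg_cst].
    by apply: cvgM cq; exact: cvgN cb.
  + move=> p v da db Dp ha hb; have [_ a0] := DJ p Dp.
    have dinv : is_derive p v (fun q => (a q)^-1) (- (a p) ^- 2 * da).
      apply: (is_derive_comp_real (phi := fun s => s^-1)) => //.
      apply: is_derive_eq; first exact: (is_deriveV a0 (is_derive_id _ _)).
      by rewrite [_%:A]mulr1.
    (* The factor 1 / (1 + (b/a)^2) equals a^2 / (a^2 + b^2), which clears the denominators coming
       from b/a. *)
    have dq := is_derive_comp_real (is_derive1_atan _) (is_deriveM hb dinv).
    have dt := is_deriveZ li (is_derive_fst p v).
    apply: (is_derive_eq (is_deriveB dq dt)).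
    rewrite (_ : (dual_coord g wb * _) p = b p / a p)// /GRing.scale /= -/(b p).
    have {}a0 : a p != 0 by [].
    have := sq0 p Dp; rewrite !expr2 => q0.
    by field; rewrite a0 q0.
  (* Along the flow a b' - b a' = [li] (a^2 + b^2), so the angular speed is [li]. *)
  + move=> p Dp; rewrite CRe CIm !dual_coordD -/a -/b -/(a p) -/(b p).
    by have := sq0 p Dp; rewrite !expr2 => q0; field.
Qed.
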